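(* Let $(\mathfrak{A},\varphi,T)$ be a state preserving $C^*$-dynamical system. Consider the following conditions: (i) for every $x\in\mathfrak{A}$, $$\lim_{n\to\infty}\frac{1}{n}\sum_{k=0}^{n-1}\|T^k(x)-\varphi(x)\mathbf{1}\|=0;$$ (ii) for every $x\in\mathfrak{A}$, $$\lim_{n\to\infty}\|T^n(x)-\varphi(x)\mathbf{1}\|=0;$$ (iii) $(\mathfrak{A},\varphi,T)$ is $\phi$-ergodic; (iv) for every state $\psi$ on $\mathfrak{A}$ and every $x\in\mathfrak{A}$, $$\lim_{n\to\infty}\psi(T^n(x))=\varphi(x).$$ Then the following implications hold: (i) $\Leftrightarrow$ (ii) $\Rightarrow$ (iii) $\Rightarrow$ (iv).
   Context: $\mathfrak{A}$ denotes a (complex) $C^*$-algebra with unit $\mathbf{1}$, and $\mathfrak{A}_+$ is its set of positive elements. A state on $\mathfrak{A}$ is a positive linear functional taking the value $1$ at $\mathbf{1}$. A Markov operator is a positive linear map $T:\mathfrak{A}\to\mathfrak{A}$ with $T\mathbf{1}=\mathbf{1}$. A state preserving $C^*$-dynamical system is a triple $(\mathfrak{A},\varphi,T)$ where $\varphi$ is a state on $\mathfrak{A}$ and $T:\mathfrak{A}\to\mathfrak{A}$ is a Markov operator with $\varphi\circ T=\varphi$. Write $\mathbb{R}_+=[0,\infty)$. Let $S_0$ be the set of all (not necessarily linear) continuous functionals $f:\mathfrak{A}_+\to\mathbb{R}_+$ such that $f(\lambda x)=\lambda f(x)$ for all $\lambda\in\mathbb{R}_+$, $x\in\mathfrak{A}_+$,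 and $f(\mathbf{1})=1$. The system $(\mathfrak{A},\varphi,T)$ is called $\phi$-ergodic (here ''$\phi$'' is merely part of the name of the notion) if, whenever $f\in S_0$ satisfies $f(T(x))=f(x)$ for all $x\in\mathfrak{A}_+$, then $f(x)=\varphi(x)$ for all $x\in\mathfrak{A}_+$. *)

(* Defs.v *)
From HB Require Import structures.
From mathcomp Require Import all_boot all_order all_algebra.
From mathcomp Require Import complex.
From mathcomp Require Import all_classical all_reals all_analysis.

Set Implicit Arguments.
Unset Strict Implicit.
Unset Printing Implicit Defensive.

Import Order.TTheory GRing.Theory Num.Theory.
Import numFieldNormedType.Exports.

Local Open Scope classical_set_scope.
Local Open Scope ring_scope.
Local Open Scope complex_scope.

(* Unital C*-algebras over R[i].  The product and the unit are fields of their
   own, rather than coming from a GRing.Algebra structure, because the join of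
   rings with normed modules is rejected by Hierarchy Builder: it would have to
   be declared before Num.NumDomain, which inherits from both.  The norm takes
   its values in R[i], as for every normedModType over R[i]; these values are
   nonnegative, hence real.  The zero algebra is not excluded, but it carries no
   state. *)
HB.mixin Record isCStarAlgebra (R : realType) A
    of CompleteNormedModule R[i] A := {
  amul : A -> A -> A ;
  aone : A ;
  star : A -> A ;
  amulA : associative amul ;
  amul1l : left_id aone amul ;
  amul1r : right_id aone amul ;
  amulDl : left_distributive amul +%R ;
  amulDr : right_distributive amul +%R ;
  amulZl : forall (a : R[i]) (x y : A), amul (a *: x) y = a *: amul x y ;
  amulZr : forall (a : R[i]) (x y : A), amul x (a *: y) = a *: amul x y ;
  starK : involutive star ;
  starD : {morph star : x y / x + y} ;
  starZ : forall (a : R[i]) (x : A), star (a *: x) = a^* *: star x ;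
  starM : forall x y : A, star (amul x y) = amul (star y) (star x) ;
  ler_norm_amul : forall x y : A, `|amul x y| <= `|x| * `|y| ;
  norm_starM : forall x : A, `|amul (star x) x| = `|x| ^+ 2
}.

#[short(type="cstarAlgType")]
HB.structure Definition CStarAlgebra (R : realType) :=
  {A of isCStarAlgebra R A & CompleteNormedModule R[i] A}.

Section CStarDynamics.
Context {R : realType} {A : cstarAlgType R}.

Definition invertible (x : A) : Prop :=
  exists y : A, amul x y = aone /\ amul y x = aone.

Definition spectrum (x : A) : set R[i] := [set l | ~ invertible (x - l *: aone)].

(* For l : R[i], 0 <= l means that l is real and nonnegative. *)
Definition positive (x : A) : Prop :=
  star x = x /\ forall l, spectrum x l -> 0 <= l.

Definition is_state (phi : {scalar A}) : Prop :=
  (forall x, positive x -> 0 <= phi x) /\ phi aone = 1.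

Definition is_markov (T : {linear A -> A}) : Prop :=
  (forall x, positive x -> positive (T x)) /\ T aone = aone.

Definition state_preserving_system (phi : {scalar A}) (T : {linear A -> A}) :
    Prop :=
  [/\ is_state phi, is_markov T & forall x, phi (T x) = phi x].

(* A functional on the positive cone is represented by a function on A of which
   only the restriction to the cone is ever used; membership in S0 and
   phi-ergodicity do not depend on the values outside the cone. *)
Definition S0 (f : A -> R) : Prop :=
  [/\ {within [set x | positive x], continuous f},
      forall x, positive x -> 0 <= f x,
      forall (l : R) x, 0 <= l -> positive x -> f (l%:C *: x) = l * f x
    & f aone = 1].

Definition phi_ergodic (phi : {scalar A}) (T : {linear A -> A}) : Prop :=
  forall f : A -> R, S0 f ->
    (forall x, positive x -> f (T x) = f x) ->
    forall x, positive x -> (f x)%:C = phi x.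

End CStarDynamics.

(* Main.v *)
(* The point of (i) => (ii) is that a Markov operator contracts the norm of
   self-adjoint elements; then |T^n x - phi(x) 1| is nonincreasing, hence
   bounded by its own Cesaro means.  Contractivity needs that one of |z|, -|z|
   lies in the spectrum of a self-adjoint z.  For this we avoid the spectral
   radius formula: if |z| = 1 and 1 - z^2 had an inverse b, the inequality
   |x|^2 <= |x^2 + y^2| for commuting self-adjoint x, y, applied to
   (1 + v^2)^2 = (2 v)^2 + (v^2 - 1)^2 with v = z, z^2, z^4, ..., would give
   2^m |z^(2^m - 1)| <= |b| |1 - z^(2^(m+1))| <= 2 |b| for all m.
   For (iii) => (iv), x |-> limsup psi(T^n x) is a T-invariant member of S0, so
   it equals phi on the positive cone; applying this to |x| 1 + x and
   |x| 1 - x gives the convergence of psi(T^n x) for self-adjoint x. *)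
Require Import Defs.
From mathcomp Require Import all_boot all_order all_algebra.
From mathcomp Require Import complex.
From mathcomp Require Import all_classical all_reals all_analysis.
From HB Require Import structures.
From mathcomp Require Import ring lra.
Import Order.TTheory GRing.Theory Num.Theory.
Import numFieldNormedType.Exports.
Local Open Scope classical_set_scope.
Local Open Scope ring_scope.
Local Open Scope complex_scope.

(* An alias of [A] carrying the ring structure given by [amul] and [aone]. *)
Definition aring {R : realType} (A : cstarAlgType R) : Type := A.

HB.instance Definition _ (R : realType) (A : cstarAlgType R) :=
  GRing.Lmodule.copy (aring A) A.
HB.instance Definition _ (R : realType) (A : cstarAlgType R) :=
  GRing.Zmodule_isPzRing.Build (aring A) (@amulA R A) (@amul1l R A)
    (@amul1r R A) (@amulDl R A) (@amulDr R A).

(** * Real-valued norm and involution on the ring alias *)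

Section Alg.
Context {R : realType} {A : cstarAlgType R}.
Local Notation B := (aring A).
Implicit Types (x y z : B) (a b : R[i]).

Definition dag (x : B) : B := star (x : A).
(** The values of the norm in [R[i]] are nonnegative reals, so the real part loses nothing and
    estimates can be made in the ordered field [R]. *)
Definition nrm (x : B) : R := complex.Re `|(x : A)|.

Lemma normE (x : A) : `|x| = (nrm x)%:C.
Proof.
rewrite /nrm; have := normr_ge0 x; case: `|x| => u v; rewrite lecE /=.
by case/andP=> /eqP ->.
Qed.

Lemma nrm_ge0 x : 0 <= nrm x.
Proof. by have := normr_ge0 (x : A); rewrite normE -[0]/(0%:C) lecR. Qed.

Lemma nrm0 : nrm 0 = 0.
Proof. by rewrite /nrm normr0. Qed.

Lemma nrm0_eq0 x : nrm x = 0 -> x = 0.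
Proof. by move=> h; apply/(@normr0_eq0 _ A); rewrite normE h. Qed.

Lemma nrmD x y : nrm (x + y) <= nrm x + nrm y.
Proof. by have := ler_normD (x : A) y; rewrite !normE -rmorphD /= lecR. Qed.

Lemma nrmN x : nrm (- x) = nrm x.
Proof. by rewrite /nrm normrN. Qed.

Lemma nrmZ a x : nrm (a *: x) = complex.Re `|a| * nrm x.
Proof.
rewrite {1}/nrm normrZ normE.
have := normr_ge0 a; case: `|a| => u v; rewrite lecE /= => /andP[/eqP-> _].
by rewrite /= mul0r subr0.
Qed.

Lemma nrmZr (r : R) x : nrm (r%:C *: x) = `|r| * nrm x.
Proof. by rewrite nrmZ normc_def /= expr0n addr0 sqrtr_sqr. Qed.

Lemma nrmM x y : nrm (x * y) <= nrm x * nrm y.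
Proof. by have := ler_norm_amul (x : A) y; rewrite !normE -rmorphM /= lecR. Qed.

Lemma nrm_dagM x : nrm (dag x * x) = nrm x ^+ 2.
Proof. 
apply/(@complexI R).
rewrite -normE (norm_starM (x : A)) normE rmorphXn//.
Qed.

Lemma dagK : involutive dag. Proof. exact: starK. Qed.
Lemma dagD x y : dag (x + y) = dag x + dag y. Proof. exact: starD. Qed.
Lemma dagM x y : dag (x * y) = dag y * dag x. Proof. exact: starM. Qed.
Lemma dagZ a x : dag (a *: x) = a^* *: dag x. Proof. exact: starZ. Qed.
Lemma dagZr (r : R) x : dag (r%:C *: x) = r%:C *: dag x.
Proof.
by rewrite dagZ conj_Creal// realE -[0]/(0%:C) !lecR -realE num_real.
Qed.
Lemma dagN x : dag (- x) = - dag x.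
Proof. by rewrite -scaleN1r dagZ rmorphN1 scaleN1r. Qed.
Lemma dag1 : dag 1 = 1.
Proof. by rewrite -[LHS]mulr1 -{2}[1]dagK -dagM mulr1 dagK. Qed.
Lemma aoneE : aone = (1 : B). Proof. by []. Qed.

Lemma scaleMl a x y : a *: x * y = a *: (x * y).
Proof. exact: amulZl. Qed.
Lemma scaleMr a x y : x * (a *: y) = a *: (x * y).
Proof. exact: amulZr. Qed.

(** The C*-identity gives |x|^2 <= |dag x| |x|; cancelling |x| yields one inequality, and [dagK]
    then yields the other. *)
Lemma nrm_dag x : nrm (dag x) = nrm x.
Proof.
wlog suff le_dag : x / nrm x <= nrm (dag x).
  by apply/eqP; rewrite eq_le le_dag -{2}[x]dagK le_dag.
have := nrmM (dag x) x; rewrite nrm_dagM expr2.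
have [-> _|x0] := eqVneq (nrm x) 0; first exact: nrm_ge0.
by rewrite ler_pM2r// lt_def x0 nrm_ge0.
Qed.

Lemma nrm_sqr x : dag x = x -> nrm (x ^+ 2) = nrm x ^+ 2.
Proof. by move=> xE; rewrite -nrm_dagM xE. Qed.

End Alg.

(** Convergence over [R[i]] quantifies over complex radii; a positive one is real, so real radii
    suffice. *)
Lemma cvg_ReP (R : realType) (V : normedModType R[i]) (u : nat -> V) (l : V) :
  u @ \oo --> l <->
  forall e : R, 0 < e -> \forall n \near \oo, complex.Re `|l - u n| < e.
Proof.
split=> [/cvgrPdist_lt h e e0|h].
  have /h : 0 < e%:C by rewrite ltcR.
  by apply: filterS => n; rewrite ltcE /= => /andP[].
apply/cvgrPdist_lt => e; rewrite lt_def => /andP[eN0].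
rewrite lecE /= => /andP[/eqP e_im e_re].
have {}/h : 0 < complex.Re e.
  rewrite lt_def e_re andbT; apply: contra eN0 => /eqP e0.
  by rewrite eq_complex /= e0 e_im !eqxx.
apply: filterS => n; rewrite ltcE => ->; rewrite andbT e_im.
by have := normr_ge0 (l - u n); rewrite lecE /= eq_sym => /andP[].
Qed.

(** * Neumann series *)

Section Neumann.
Context {R : realType} {A : cstarAlgType R}.
Local Notation B := (aring A).
Implicit Types (x y z : B) (a b : R[i]).

Lemma invertibleE (x : A) :
  invertible x <-> exists y : B, (x : B) * y = 1 /\ y * (x : B) = 1.
Proof. by []. Qed.

(** The unit is a self-adjoint idempotent, so its norm equals its own square. The value 0 occurs in
    the zero algebra, hence an inequality. *)
Lemma nrm1_le1 : nrm (1 : B) <= 1.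
Proof.
have := nrm_sqr (1 : B) dag1; rewrite expr1n => h.
have [-> //|n0] := eqVneq (nrm (1 : B)) 0.
rewrite -(ler_pM2l (x := nrm (1 : B))) ?lt_def ?n0 ?nrm_ge0// -expr2 -h.
by rewrite mulr1.
Qed.

Lemma nrmX x n : nrm (x ^+ n) <= nrm x ^+ n.
Proof.
elim: n => [|n IH]; first by rewrite !expr0 nrm1_le1.
by rewrite !exprS (le_trans (nrmM _ _))// ler_wpM2l ?nrm_ge0.
Qed.

(** Multiplying by 1 - |x| keeps the geometric bound free of division and makes the right-hand side
    telescope in [p]. *)
Lemma nrm_geometric_tail x n p : nrm x < 1 ->
  nrm (\sum_(n <= i < n + p) x ^+ i) * (1 - nrm x) <=
  nrm x ^+ n - nrm x ^+ (n + p).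
Proof.
move=> x1; have x10 : 0 <= 1 - nrm x by rewrite subr_ge0 ltW.
elim: p => [|p IH].
  by rewrite addn0 big_geq// nrm0 mul0r subrr.
rewrite addnS big_nat_recr ?leq_addr//=.
apply: (le_trans (ler_wpM2r x10 (nrmD _ _))); rewrite mulrDl.
have := lerD IH (ler_wpM2r x10 (nrmX x (n + p))).
by rewrite exprSr; lra.
Qed.

Lemma geometric_sum_cauchy x : nrm x < 1 ->
  cauchy ((fun n => \sum_(0 <= i < n) x ^+ i : A) @ \oo).
Proof.
move=> x1; have x10 : 0 < 1 - nrm x by rewrite subr_gt0.
apply: cauchy_exP => e e0.
have [r r0 re] : exists2 r : R, 0 < r & r%:C = e.
  by case: e e0 => u v; rewrite ltcE /= => /andP[/eqP -> u0]; exists u.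
(* The factor 1 - |x| matches the one on the left of [nrm_geometric_tail]. *)
have /cvgrPdist_lt/(_ (r * (1 - nrm x))) :
    (fun n => nrm x ^+ n) @ \oo --> (0 : R).
  by apply: cvg_expr; rewrite ger0_norm ?nrm_ge0.
case; first by rewrite mulr_gt0.
move=> N _ hN; exists (\sum_(0 <= i < N) x ^+ i : A); exists N => // n /= Nn.
rewrite -ball_normE /= distrC -(subnKC Nn).
rewrite (@big_cat_nat _ _ _ N)//= ?leq_addr// addrAC subrr add0r.
rewrite -re normE ltcR -(ltr_pM2r x10).
apply: (le_lt_trans (nrm_geometric_tail _ _ _ x1)).
have := hN N (leqnn N); rewrite sub0r normrN ger0_norm ?exprn_ge0 ?nrm_ge0//.
have : 0 <= nrm x ^+ (N + (n - N)) by rewrite exprn_ge0 ?nrm_ge0.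
lra.
Qed.

(** The inverse is the sum [l] of the Neumann series: 1 - x times its n-th partial sum is 1 - x^n,
    and x^n tends to 0. *)
Lemma invertible_1B x : nrm x < 1 -> invertible (1 - x).
Proof.
move=> x1; have /cauchy_cvg/cvg_ex [l /cvg_ReP Sl] := geometric_sum_cauchy _ x1.
have Xl : (fun n => nrm x ^+ n) @ \oo --> (0 : R).
  by apply: cvg_expr; rewrite ger0_norm ?nrm_ge0.
have small (e : R) : 0 < e ->
    exists n, nrm ((l : B) - \sum_(i < n) x ^+ i) < e /\ nrm x ^+ n < e.
  move=> e0; near \oo => n; exists n; split.
    by near: n; apply: filterS (Sl e e0) => n; rewrite big_mkord.
  rewrite -[ltLHS]ger0_norm ?exprn_ge0 ?nrm_ge0// -normrN -[- _]add0r.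
  by near: n; exact: (cvgrPdist_lt _ _).1 Xl e e0.
(* Two errors below e / K then contribute at most |1 - x| e / K + e / K = e; the summand 1 keeps [K]
   positive. *)
pose K := nrm (1 - x) + 1.
have K0 : 0 < K by rewrite ltr_wpDl ?nrm_ge0.
(* Used for y = (1 - x) l - 1 and y = l (1 - x) - 1: in both cases y + x^n is the product of 1 - x
   and the remainder of the series. *)
have inverse (y : B) :
    (forall n, nrm (y + x ^+ n) <=
      nrm (1 - x) * nrm ((l : B) - \sum_(i < n) x ^+ i)) -> y = 0.
  move=> hy; apply/nrm0_eq0/eqP.
  rewrite eq_le nrm_ge0 andbT; apply/ler_addgt0Pl => e e0; rewrite addr0.
  have [n [n1 n2]] := small (e / K) (divr_gt0 e0 K0).
  rewrite -[y](addrK (x ^+ n)); apply: (le_trans (nrmD _ _)); rewrite nrmN.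
  apply: (le_trans (lerD (hy n) (nrmX _ _))).
  have -> : e = nrm (1 - x) * (e / K) + e / K.
    by rewrite -{2}[e / K]mul1r -mulrDl mulrCA divff ?mulr1 ?gt_eqF.
  by rewrite lerD ?ler_wpM2l ?nrm_ge0// ltW.
have tele n : (1 - x) * (\sum_(i < n) x ^+ i) = 1 - x ^+ n.
  by rewrite -opprB mulNr -subrX1 opprB.
have teler n : (\sum_(i < n) x ^+ i) * (1 - x) = 1 - x ^+ n.
  rewrite -tele; apply/commr_sym/commr_sum => i _; apply/commrX/commr_sym.
  exact/commrB/commr_refl/commr1.
exists l; split; apply/eqP; rewrite -subr_eq0; apply/eqP/inverse => n.
  rewrite -[leLHS]/(nrm ((1 - x) * l - 1 + x ^+ n)).
  rewrite -addrA -[- 1 + _]opprK opprD opprK.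
  by rewrite -tele -mulrBr nrmM.
rewrite -[leLHS]/(nrm ((l : B) * (1 - x) - 1 + x ^+ n)).
rewrite -addrA -[- 1 + _]opprK opprD opprK.
by rewrite -teler -mulrBl mulrC nrmM.
Unshelve. all: end_near.
Qed.
End Neumann.

(** * Spectra of self-adjoint elements *)

Section Spectrum.
Context {R : realType} {A : cstarAlgType R}.
Local Notation B := (aring A).
Implicit Types (x y z : B) (a b l : R[i]) (r c t : R).

Lemma invertibleM x y : invertible x -> invertible y -> invertible (x * y).
Proof.
move=> /invertibleE[x' [xx' x'x]] /invertibleE[y' [yy' y'y]].
apply/invertibleE; exists (y' * x'); split.
  by rewrite mulrA -(mulrA x) yy' mulr1.
by rewrite mulrA -(mulrA y') x'x mulr1.
Qed.

Lemma invertibleZ a x : a != 0 -> invertible x -> invertible (a *: x).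
Proof.
move=> a0 /invertibleE[y [xy yx]]; apply/invertibleE; exists (a^-1 *: y).
by rewrite !scaleMl !scaleMr !scalerA xy yx mulfV// mulVf// scale1r.
Qed.

Lemma invertibleN x : invertible x -> invertible (- x).
Proof. by rewrite -scaleN1r; apply: invertibleZ; rewrite oppr_eq0 oner_eq0. Qed.

(** If |x| < |l|, then x - l = -l (1 - x / l) is invertible by the Neumann series. *)
Lemma spectrum_norm x l : spectrum x l -> complex.Re `|l| <= nrm x.
Proof.
move=> xl; rewrite leNgt; apply/negP => lt_xl; apply: xl.
have l0 : l != 0.
  by apply: contraTN lt_xl => /eqP ->; rewrite normr0 -leNgt nrm_ge0.
have -> : x - l *: (1 : B) = - l *: (1 - l^-1 *: x).
  by rewrite scalerBr scalerA mulNr mulfV// scaleN1r opprK scaleNr addrC.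
apply: invertibleZ; first by rewrite oppr_eq0.
apply: invertible_1B; rewrite nrmZ normrV ?unitfE//.
have l_gt0 := le_lt_trans (nrm_ge0 x) lt_xl.
have -> : `|l| = (complex.Re `|l|)%:C.
  have := normr_ge0 l; case: `|l| => u v.
  by rewrite lecE /= => /andP[/eqP -> _].
by rewrite -fmorphV /= mulrC ltr_pdivrMr// mul1r.
Qed.

Lemma spectrumDscalar x l b : spectrum x l ->
  spectrum (x + b *: (1 : B)) (l + b).
Proof. by rewrite /spectrum /= aoneE scalerDl opprD addrACA subrr addr0. Qed.

Lemma spectrumN x l : spectrum x l -> spectrum (- x) (- l).
Proof.
rewrite /spectrum /= aoneE scaleNr opprK => xl nxl; apply: xl.
by rewrite -[_ - _]opprK opprB addrC; exact: invertibleN.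
Qed.

(* Arens' trick: l + i t lies in the spectrum of x + i t for every real t, and
   |x + i t|^2 <= |x|^2 + t^2. *)
Lemma spectrum_selfadjoint_Im x l : dag x = x ->
  spectrum x l -> complex.Im l = 0.
Proof.
move=> xs; case: l => a b xl /=.
have bound t : a ^+ 2 + (b + t) ^+ 2 <= nrm x ^+ 2 + t ^+ 2.
  have := spectrum_norm _ _ (spectrumDscalar _ _ (0 +i* t) xl).
  rewrite normc_def /= addr0 => le1.
  have := nrm_dagM (x + (0 +i* t) *: (1 : B)).
  have -> : dag (x + (0 +i* t) *: (1 : B)) * (x + (0 +i* t) *: (1 : B)) =
     x ^+ 2 + (t ^+ 2)%:C *: (1 : B).
    have -> : dag (x + (0 +i* t) *: (1 : B)) = x - (0 +i* t) *: (1 : B).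
      rewrite dagD dagZ dag1 xs -scaleNr; congr (_ + _ *: _).
      by rewrite -[LHS]/(0 -i* t); apply/eqP; rewrite eq_complex /= oppr0 !eqxx.
    rewrite mulrDr !mulrDl !mulNr !scaleMl !scaleMr !mul1r !mulr1 scalerA.
    rewrite addrA subrK -scaleNr; congr (_ + _ *: _).
    by apply/eqP; rewrite eq_complex /=; apply/andP; split; apply/eqP; ring.
  move=> eqn.
  have : Num.sqrt (a ^+ 2 + (b + t) ^+ 2) ^+ 2 <=
      nrm (x + (0 +i* t) *: (1 : B)) ^+ 2.
    by rewrite ler_sqr// nnegrE ?sqrtr_ge0 ?nrm_ge0.
  rewrite sqr_sqrtr ?addr_ge0 ?sqr_ge0// => /le_trans; apply.
  rewrite -eqn (le_trans (nrmD _ _))// lerD//.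
    by rewrite (le_trans (nrmX _ _)).
  by rewrite nrmZr ger0_norm ?sqr_ge0// ler_piMr ?sqr_ge0 ?nrm1_le1.
apply/eqP/negP => /negP b0.
(* Expanding [bound] leaves a^2 + b^2 + 2 b t <= |x|^2, and this [t] makes 2 b t equal to |x|^2 +
   1. *)
have := bound ((nrm x ^+ 2 + 1) / (2 * b)).
have : (2 * b) * ((nrm x ^+ 2 + 1) / (2 * b)) = nrm x ^+ 2 + 1.
  by rewrite mulrC divfK// mulf_neq0// pnatr_eq0.
set t := _ / _ => ht; have := sqr_ge0 a; have := sqr_ge0 b.
rewrite sqrrD; lra.
Qed.

Lemma spectrum_selfadjoint x l : dag x = x -> spectrum x l ->
  exists2 r : R, l = r%:C & `|r| <= nrm x.
Proof.
move=> xs xl; have := spectrum_selfadjoint_Im _ _ xs xl.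
have := spectrum_norm _ _ xl; case: l {xl} => r s.
by rewrite normc_def /= => + s0; rewrite s0 expr0n addr0 sqrtr_sqr; exists r.
Qed.

(** The spectrum of [x] lies in [-|x|, |x|], so the shift by [c] makes it nonnegative. Through these
    elements, positivity of operators and states turns into norm bounds. *)
Lemma positive_scalarD x c : dag x = x -> nrm x <= c ->
  positive (c%:C *: (1 : B) + x).
Proof.
move=> xs xc; split.
  by rewrite -[LHS]/(dag (c%:C *: (1 : B) + x)) dagD dagZr dag1 xs.
move=> l /(spectrumDscalar _ _ (- c%:C)).
rewrite addrAC scaleNr subrr add0r => /(spectrum_selfadjoint _ _ xs)[r lE rx].
rewrite -(subrK c%:C l) lE -rmorphD /= -[0]/(0%:C) lecR.
have := le_trans rx xc; rewrite ler_norml => /andP[]; lra.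
Qed.

Lemma positive_scalar c : 0 <= c -> positive (c%:C *: (1 : B)).
Proof.
move=> c0; rewrite -[X in positive X]addr0.
by apply: positive_scalarD; rewrite ?nrm0// -(scale0r 0) dagZ rmorph0 !scale0r.
Qed.

Lemma nrmMn2 x : nrm (x *+ 2) = 2 * nrm x.
Proof.
by rewrite -scaler_nat -(rmorph_nat (real_complex R)) nrmZr normr_nat.
Qed.

(** For w = x + i y, commutation gives [dag w * w] = x^2 + y^2, of norm |w|^2, while 2 x = w +
    [dag w] gives |x| <= |w|. *)
Lemma nrm_le_sqrD x y : dag x = x -> dag y = y -> GRing.comm x y ->
  nrm x ^+ 2 <= nrm (x ^+ 2 + y ^+ 2).
Proof.
move=> xs ys xy; pose w := x + 'i *: y.
have wd : dag w = x - 'i *: y.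
  by rewrite /w dagD dagZ xs ys conjCi scaleNr.
have <- : dag w * w = x ^+ 2 + y ^+ 2.
  rewrite wd /w mulrDr !mulrDl !mulNr !scaleMl !scaleMr scalerA xy.
  by rewrite addrA subrK -(expr2 'i) sqrCi scaleN1r opprK.
rewrite nrm_dagM ler_sqr ?nnegrE ?nrm_ge0//.
have := nrmD w (dag w).
by rewrite nrm_dag wd /w addrACA subrr addr0 -mulr2n nrmMn2; lra.
Qed.

Lemma dagM_comm x y : dag x = x -> dag y = y -> GRing.comm x y ->
  dag (x * y) = x * y.
Proof. by move=> xs ys xy; rewrite dagM xs ys xy. Qed.

Lemma dagX x n : dag x = x -> dag (x ^+ n) = x ^+ n.
Proof.
move=> xs; elim: n => [|n IH]; first by rewrite expr0 dag1.
by rewrite exprS dagM xs IH -exprSr exprS.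
Qed.

(** [nrm_le_sqrD] applied to 2 v x and (v^2 - 1) x, whose squares add up to ((v^2 + 1) x)^2. The
    factor [x] allows the estimate to be iterated. *)
Lemma nrm_sqrD1_ge v x : dag v = v -> dag x = x -> GRing.comm v x ->
  2 * nrm (v * x) <= nrm ((v ^+ 2 + 1) * x).
Proof.
move=> vs xs vx.
have v2 : dag (v ^+ 2) = v ^+ 2 by rewrite expr2 dagM vs.
have cx y : GRing.comm v y -> GRing.comm (v ^+ 2) y.
   by move=> ?; apply/commr_sym/commrX/commr_sym.
have c1 : GRing.comm (v ^+ 2 + 1) x.
  exact/commr_sym/commrD/commr1/commr_sym/cx.
have c2 : GRing.comm (v ^+ 2 - 1) x.
  exact/commr_sym/commrB/commr1/commr_sym/cx.
have s1 : dag ((v ^+ 2 + 1) * x) = (v ^+ 2 + 1) * x.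
  by apply: dagM_comm => //; rewrite dagD v2 dag1.
have s2 : dag ((v ^+ 2 - 1) * x) = (v ^+ 2 - 1) * x.
  by apply: dagM_comm => //; rewrite dagD v2 dagN dag1.
have s3 : dag ((v * x) *+ 2) = (v * x) *+ 2.
  by rewrite mulr2n dagD dagM_comm.
rewrite -(@ler_sqr R) ?nnegrE ?mulr_ge0 ?nrm_ge0// -nrm_sqr//.
have -> : 2 * nrm (v * x) = nrm ((v * x) *+ 2).
  by rewrite nrmMn2.
have -> : ((v ^+ 2 + 1) * x) ^+ 2 = (v * x *+ 2) ^+ 2 + ((v ^+ 2 - 1) * x) ^+ 2.
  rewrite exprMn_comm// exprMn_comm// exprMn_n exprMn_comm// -mulrnAl -mulrDl.
  congr (_ * _); rewrite sqrrD1 sqrrB1 [RHS]addrA; congr (_ + _).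
  by rewrite [RHS]addrCA -mulrnBr.
apply: nrm_le_sqrD => //.
have cvx y : GRing.comm v y -> GRing.comm x y -> GRing.comm (v * x *+ 2) y.
  by move=> vy xy; apply/commr_sym/commrMn/commrM; apply/commr_sym.
apply: commrM; apply: cvx => //.
exact/commrB/commr1/commrX/commr_refl.
Qed.

Lemma unit_norm_sqr_spectrum z : dag z = z -> nrm z = 1 ->
  ~ invertible (1 - z ^+ 2 : B).
Proof.
move=> zs z1 [b [_ bz]].
(* The statement is general in [x] because the induction hypothesis is applied to (v^2 + 1) x with v
   = z^(2^m). On the right (1 - v^2)(1 + v^2) = 1 - v^4 doubles the exponent; on the left
   [nrm_sqrD1_ge] yields a factor 2. *)
have grow m x : dag x = x -> GRing.comm z x ->
    2 ^+ m * nrm (z ^+ (2 ^ m - 1) * x) <=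
    nrm (b : B) * nrm ((1 - z ^+ (2 ^ m.+1)) * x).
  elim: m x => [|m IH] x xs zx.
    rewrite expn0 subnn !expr0 !mul1r expn1.
    apply: le_trans (nrmM _ _); rewrite mulrA.
    have -> : (b : B) * (1 - z ^+ 2) = 1 by exact: bz.
    by rewrite mul1r.
  pose v := z ^+ (2 ^ m).
  have vs : dag v = v by exact: dagX.
  have zv : GRing.comm z v by exact/commrX/commr_refl.
  have vx : GRing.comm v x by exact/commr_sym/commrX/commr_sym.
  have vv : v ^+ 2 = z ^+ (2 ^ m.+1) by rewrite -exprM expnSr.
  have v2s : dag (v ^+ 2 + 1) = v ^+ 2 + 1 by rewrite dagD expr2 dagM vs dag1.
  have v2x : GRing.comm (v ^+ 2 + 1) x.
    exact/commr_sym/commrD/commr1/commrX/commr_sym.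
  have /IH : dag ((v ^+ 2 + 1) * x) = (v ^+ 2 + 1) * x by exact: dagM_comm.
  have -> : (1 - z ^+ (2 ^ m.+1)) * ((v ^+ 2 + 1) * x) =
      (1 - z ^+ (2 ^ m.+2)) * x.
    rewrite mulrA; congr (_ * _).
    rewrite -vv [(2 ^ m.+2)%N]expnSr exprM -vv -[1 - v ^+ 2]opprB mulNr.
    by rewrite -subr_sqr_1 opprB.
  move=> /(_ _) le1; apply: le_trans (le1 _); last first.
    apply: commrM => //; apply: commrD; last exact: commr1.
    exact: commrX.
  rewrite exprSr -mulrA ler_wpM2l ?exprn_ge0//.
  have zx1 : GRing.comm v (z ^+ (2 ^ m - 1) * x).
    by apply: commrM => //; exact/commrX/commr_sym.
  have zx2 : dag (z ^+ (2 ^ m - 1) * x) = z ^+ (2 ^ m - 1) * x.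
    apply: dagM_comm => //; last exact/commr_sym/commrX/commr_sym.
    exact: dagX.
  have := nrm_sqrD1_ge _ _ vs zx2 zx1.
  have -> : v * (z ^+ (2 ^ m - 1) * x) = z ^+ (2 ^ m.+1 - 1) * x.
    rewrite mulrA -exprD; congr (z ^+ _ * _).
    by rewrite addnBA ?expn_gt0// addnn -mul2n -expnS.
  move=> /le_trans; apply.
  rewrite mulrA [_ * z ^+ _](_ : _ = z ^+ (2 ^ m - 1) * (v ^+ 2 + 1)) -?mulrA//.
  apply/commr_sym/commrD; last exact: commr1.
  by apply/commrX; apply/commr_sym/commrX/commr_sym.
have pow_nrm m : nrm (z ^+ (2 ^ m)) = 1.
  elim: m => [|m IHm]; first by rewrite expn0 expr1.
  by rewrite expnSr exprM nrm_sqr ?dagX// IHm expr1n.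
(* Multiplying by one more [z], of norm 1, reaches z^(2^m), whose norm is 1. *)
have pow_nrm1 m : 1 <= nrm (z ^+ (2 ^ m - 1)).
  have pow_gt0 : (0 < 2 ^ m)%N by rewrite expn_gt0.
  rewrite -(pow_nrm m) -{1}(subnK pow_gt0).
  by rewrite exprD expr1 (le_trans (nrmM _ _))// z1 mulr1.
have bounded m : 2 ^+ m <= 2 * nrm (b : B).
  have := grow m 1 dag1 (commr1 _); rewrite !mulr1 => grow1.
  have := ler_wpM2l (exprn_ge0 m (ler0n R 2)) (pow_nrm1 m).
  rewrite mulr1 => /le_trans -> //; apply: le_trans grow1 _.
  rewrite mulrC ler_wpM2r ?nrm_ge0// (le_trans (nrmD _ _))// nrmN pow_nrm.
  by have := nrm1_le1 (A := A); lra.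
have b0 : 0 <= 2 * nrm (b : B) by rewrite mulr_ge0 ?nrm_ge0.
(* A natural number m above 2 |b| contradicts m <= 2^m <= 2 |b|. *)
have := archi_boundP b0; apply/negP; rewrite -leNgt.
apply: le_trans (bounded (Num.bound (2 * nrm (b : B)))).
by rewrite -natrX ler_nat ltnW// ltn_expl.
Qed.

(** After normalising to w = z / |z|, the element 1 - w^2 is a nonzero multiple of (z - |z|)(z +
    |z|), so the two factors cannot both be invertible. *)
Lemma nrm_in_spectrum z : dag z = z -> 0 < nrm z ->
  spectrum z (nrm z)%:C \/ spectrum z (- (nrm z)%:C).
Proof.
move=> zs z0; apply/not_andP => -[zp zm].
have {}zp : invertible (z - (nrm z)%:C *: (1 : B)) by apply: contrapT.
have {}zm : invertible (z - (- (nrm z)%:C) *: (1 : B)) by apply: contrapT.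
pose w := (nrm z)^-1%:C *: z.
have ws : dag w = w by rewrite dagZr zs.
have w1 : nrm w = 1 by rewrite nrmZr ger0_norm ?invr_ge0 ?ltW// mulVf ?gt_eqF.
apply: (unit_norm_sqr_spectrum w ws w1).
have -> : 1 - w ^+ 2 = - ((nrm z)^-1 ^+ 2)%:C *:
   ((z - (nrm z)%:C *: (1 : B)) * (z - (- (nrm z)%:C) *: (1 : B))).
  set c := nrm z; have c0 : c != 0 by rewrite gt_eqF.
  have -> : (z - c%:C *: (1 : B)) * (z - (- c%:C) *: (1 : B)) =
      z ^+ 2 - (c ^+ 2)%:C *: (1 : B).
    rewrite scaleNr opprK mulrDr !mulrBl !scaleMl !scaleMr !mul1r !mulr1.
    by rewrite addrA subrK scalerA -rmorphM /= -!expr2.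
  rewrite scaleNr scalerBr scalerA -rmorphM /= exprVn mulVf ?expf_neq0//.
  by rewrite scale1r opprB /w !expr2 scaleMl scaleMr scalerA -rmorphM /= invfM.
apply: invertibleZ; last exact: invertibleM.
rewrite oppr_eq0 -[0]/(0%:C) (inj_eq (@complexI R)) expf_neq0//.
by rewrite invr_eq0 gt_eqF.
Qed.

End Spectrum.

(** * Real and complex limits, Cesaro means *)

Lemma cvg_realP (R : realType) (u : nat -> R) (l : R) :
  (fun n => (u n)%:C : R[i]^o) @ \oo --> (l%:C : R[i]^o) <-> u @ \oo --> l.
Proof.
rewrite cvg_ReP; split=> [h|/cvgrPdist_lt h].
  apply/cvgrPdist_lt => e e0; have := h e e0; apply: filterS => n.
  by rewrite -rmorphB normc_def /= expr0n addr0 sqrtr_sqr.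
move=> e e0; have := h e e0; apply: filterS => n.
by rewrite -rmorphB normc_def /= expr0n addr0 sqrtr_sqr.
Qed.

Lemma cvg_cartesian (R : realType) (u v : nat -> R[i]^o) (a b : R[i]^o) :
  u @ \oo --> a -> v @ \oo --> b ->
  (fun n => u n + 'i * v n : R[i]^o) @ \oo --> (a + 'i * b : R[i]^o).
Proof.
rewrite !cvg_ReP => ua vb e e0; have e2 : 0 < e / 2 by rewrite divr_gt0.
apply: filterS2 (ua _ e2) (vb _ e2) => n ltu ltv.
rewrite opprD addrACA -mulrBr.
have := ler_normD (a - u n : R[i]) ('i * (b - v n)).
rewrite normrM normCi mul1r lecE => /andP[_ /le_lt_trans]; apply.
by rewrite raddfD /= (splitr e) ltrD.
Qed.

Lemma mean_ge_last (R : realType) (u : nat -> R) n :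
  nonincreasing_seq u ->
  u n <= n.+1%:R^-1 * \sum_(0 <= k < n.+1) u k.
Proof.
move=> u_dec; rewrite mulrC ler_pdivlMr ?ltr0n//.
have -> : u n * n.+1%:R = \sum_(0 <= k < n.+1) u n.
  by rewrite sumr_const_nat subn0 mulr_natr.
by rewrite !big_mkord ler_sum// => k _; rewrite u_dec// -ltnS.
Qed.

Lemma cvg0_mean (R : realType) (u : nat -> R) : u @ \oo --> (0 : R) ->
  (fun n => n%:R^-1 * \sum_(0 <= k < n) u k) @ \oo --> (0 : R).
Proof.
(* [cesaro] divides a sum of n + 1 terms by n + 1; the shift skips n = 0, where the mean is 0 by
   convention. *)
by move=> /cesaro h; rewrite -cvg_shiftS.
Qed.

Lemma mean_cvg0 (R : realType) (u : nat -> R) : (forall n, 0 <= u n) ->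
  nonincreasing_seq u ->
  (fun n => n%:R^-1 * \sum_(0 <= k < n) u k) @ \oo --> (0 : R) ->
  u @ \oo --> (0 : R).
Proof.
move=> u_ge0 u_dec mean0.
apply: (squeeze_cvgr _ (@cvg_cst _ 0 _ _ _)); last first.
  by rewrite -cvg_shiftS in mean0; exact: mean0.
by near=> n; rewrite u_ge0 mean_ge_last.
Unshelve. all: end_near.
Qed.

(** * Markov operators and states on self-adjoint elements *)

Section Dynamics.
Context {R : realType} {A : cstarAlgType R}.
Local Notation B := (aring A).
Implicit Types (x y z : B) (r c e : R).
Implicit Types (phi psi : {scalar A}) (T : {linear A -> A}).

Lemma positive_dag x : positive x -> dag x = x.
Proof. by case. Qed.

Lemma positive1 : positive (1 : B).
Proof. by have := positive_scalar (A := A) _ ler01; rewrite scale1r. Qed.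

Lemma markov_scalar T r : is_markov T -> T (r%:C *: (1 : B)) = r%:C *: (1 : B).
Proof. by case=> _ T1; rewrite linearZ /= -[X in T X]/(aone : A) T1. Qed.

(** The image of the positive element |x| 1 + x is positive, hence self-adjoint, and [T] fixes |x|
    1. *)
Lemma markov_dag T x : is_markov T -> dag x = x -> dag (T x : B) = T x.
Proof.
move=> mT xs; have [Tpos _] := mT.
have [+ _] := Tpos _ (positive_scalarD x (nrm x) xs (lexx _)).
rewrite linearD markov_scalar// => h.
apply: (@addrI _ ((nrm x)%:C *: (1 : B))); rewrite -[RHS]h.
by rewrite -[RHS]/(dag (_ + (T x : B))) dagD dagZr dag1.
Qed.

(** One of |T x|, -|T x| lies in the spectrum of T x. Hence |x| - |T x| lies in the spectrum of T
    (|x| 1 - x) or of T (|x| 1 + x), both positive. *)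
Lemma markov_le T x : is_markov T -> dag x = x -> nrm (T x : B) <= nrm x.
Proof.
move=> mT xs; have [Tpos _] := mT.
have Txs := markov_dag T x mT xs.
have xNs : dag (- x) = - x by rewrite dagN xs.
have xNle : nrm (- x) <= nrm x by rewrite nrmN.
have [Tx0|Tx_gt0] := leP (nrm (T x : B)) 0.
  by rewrite (le_trans Tx0)// nrm_ge0.
suff : (0 : R[i]) <= - (nrm (T x : B))%:C + (nrm x)%:C.
  by rewrite addrC -rmorphB -[0]/(0%:C) lecR subr_ge0.
case: (nrm_in_spectrum _ Txs Tx_gt0) =>
  [/spectrumN|] /(spectrumDscalar _ _ (nrm x)%:C).
  have [_] := Tpos _ (positive_scalarD (- x) (nrm x) xNs xNle).
  by rewrite linearD markov_scalar// linearN addrC; apply.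
have [_] := Tpos _ (positive_scalarD x (nrm x) xs (lexx _)).
by rewrite linearD markov_scalar// addrC; apply.
Qed.

(** Both |x| 1 + x and |x| 1 - x are positive, so |x| + psi x and |x| - psi x are nonnegative
    reals. *)
Lemma state_selfadjoint psi x : is_state psi -> dag x = x ->
  psi x = (complex.Re (psi x))%:C /\ `|complex.Re (psi x)| <= nrm x.
Proof.
move=> [psi_pos psi1] xs.
have psic c : psi (c%:C *: (1 : B)) = c%:C.
  by rewrite linearZ /= -[X in psi X]/(aone : A) psi1 mulr1.
have xNs : dag (- x) = - x by rewrite dagN xs.
have xNle : nrm (- x) <= nrm x by rewrite nrmN.
have := psi_pos _ (positive_scalarD x (nrm x) xs (lexx _)).
have := psi_pos _ (positive_scalarD (- x) (nrm x) xNs xNle).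
rewrite !linearD linearN psic; case: (psi x) => u v.
rewrite !lecE /= => /andP[_ le1] /andP[/eqP v0 le2]; split.
  by move: v0; rewrite add0r => ->.
by rewrite ler_norml; apply/andP; split; lra.
Qed.

Lemma cartesian_decomposition x :
  exists a b, [/\ dag a = a, dag b = b & x = a + 'i *: b].
Proof.
exists ((2^-1)%:C *: (x + dag x)), ((2^-1)%:C *: ('i *: (dag x - x))).
split.
- by rewrite dagZr dagD dagK addrC.
- rewrite dagZr dagZ conjCi dagD dagN dagK; congr (_ *: _).
  by rewrite scaleNr -scalerN opprB.
rewrite !scalerA mulrAC -(expr2 'i) sqrCi mulN1r scaleNr -scalerN opprB.
rewrite -scalerDr addrACA subrr addr0 -mulr2n -[x *+ 2]scaler_nat scalerA.
by rewrite -(rmorph_nat (real_complex R)) -rmorphM mulVf ?pnatr_eq0// scale1r.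
Qed.

(** [iter n T] is a bare function; bundling it as a linear map makes the results on Markov operators
    apply to the iterates. *)
Lemma iter_markov T n : is_markov T ->
  exists2 S : {linear A -> A}, is_markov S & forall x : A, S x = iter n T x.
Proof.
move=> [Tpos T1]; elim: n => [|n [S [Spos S1] Sn]].
  by exists idfun.
exists (T \o S); first by split=> [x /Spos/Tpos|] //=; rewrite S1.
by move=> x /=; rewrite Sn.
Qed.

Lemma state_iter psi T n : is_state psi -> is_markov T ->
  exists2 psi_n : {scalar A}, is_state psi_n &
    forall x : A, psi_n x = psi (iter n T x).
Proof.
move=> [psi_pos psi1] mT; have [S [Spos S1] Sn] := iter_markov T n mT.
exists (psi \o S); first by split=> [x /Spos/psi_pos|] //=; rewrite S1.
by move=> x /=; rewrite Sn.
Qed.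

(** * Distance of the orbit from its expected limit *)

Definition errn phi T x (n : nat) : R :=
  nrm (iter n T x - phi x *: aone : B).

(** Since T fixes scalars, T^(n+1) x - phi(x) 1 is the image under [T] of T^n x - phi(x) 1, which is
    self-adjoint because phi(x) is real; [markov_le] concludes. *)
Lemma errn_nonincreasing phi T x : state_preserving_system phi T ->
  dag x = x -> nonincreasing_seq (errn phi T x).
Proof.
move=> [phi_st mT phiT] xs; apply/nonincreasing_seqP => n.
have [S mS Sn] := iter_markov T n mT.
have [phix _] := state_selfadjoint phi x phi_st xs.
set c := complex.Re (phi x) in phix.
have := markov_le T (S x - c%:C *: (1 : B)) mT.
have -> : T (S x - c%:C *: (1 : B)) = (T (S x) : B) - c%:C *: (1 : B).
  by rewrite -[in RHS](markov_scalar T c mT) -linearB.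
rewrite /errn iterS phix Sn; apply.
by rewrite dagD dagN dagZr dag1 -Sn markov_dag.
Qed.

Lemma cvg_mean_errnE phi T x :
  (fun n => (n%:R^-1 * \sum_(0 <= k < n) `|iter k T x - phi x *: aone|
     : R[i]^o)) @ \oo --> (0 : R[i]^o) <->
  (fun n => n%:R^-1 * \sum_(0 <= k < n) errn phi T x k) @ \oo --> (0 : R).
Proof.
rewrite -cvg_realP.
suff -> : (fun n => (n%:R^-1 * \sum_(0 <= k < n) `|iter k T x - phi x *: aone|
     : R[i]^o)) =
    (fun n => ((n%:R^-1 * \sum_(0 <= k < n) errn phi T x k)%:C : R[i]^o)).
  by [].
apply/funext => n; rewrite rmorphM fmorphV rmorph_nat rmorph_sum /=.
by congr (_ * _); apply: eq_bigr => k _; exact: normE.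
Qed.

Lemma cvg_errnE phi T x :
  (fun n => (`|iter n T x - phi x *: aone| : R[i]^o)) @ \oo --> (0 : R[i]^o) <->
  errn phi T x @ \oo --> (0 : R).
Proof.
rewrite -cvg_realP.
suff -> : (fun n => (`|iter n T x - phi x *: aone| : R[i]^o)) =
   (fun n => ((errn phi T x n)%:C : R[i]^o)) by [].
by apply/funext => n; exact: normE.
Qed.

Lemma iter_linear T n a x y :
  iter n T (x + a *: y) = (iter n T x : A) + a *: (iter n T y : A).
Proof. by elim: n => //= n ->; rewrite linearD linearZ. Qed.

Lemma errn_cartesian phi T x y n :
  errn phi T (x + 'i *: y) n <= errn phi T x n + errn phi T y n.
Proof.
have phiD : phi (x + 'i *: y) = phi x + 'i * phi y by rewrite linearD linearZ.
rewrite /errn iter_linear phiD scalerDl opprD addrACA.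
rewrite -scalerA -scalerBr (le_trans (nrmD _ _))// lerD2l nrmZ.
by rewrite normCi /= mul1r.
Qed.

(** Monotonicity of the error is established for self-adjoint elements; this extends the resulting
    limit to all of [A] through the Cartesian decomposition. *)
Lemma cvg0_errn phi T :
  (forall x, dag x = x -> errn phi T x @ \oo --> (0 : R)) ->
  forall x, errn phi T x @ \oo --> (0 : R).
Proof.
move=> sa x; have [a [b [/sa a0 /sa b0 ->]]] := cartesian_decomposition x.
have := cvgD a0 b0; rewrite addr0 => ab0.
apply: (squeeze_cvgr _ (@cvg_cst _ 0 _ _ _)); last exact: ab0.
by near=> n; rewrite nrm_ge0 errn_cartesian.
Unshelve. all: end_near.
Qed.

(** By invariance f(x) = f(T^n x), and by continuity and homogeneity f(T^n x) tends to f(phi(x) 1) =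
    phi(x). *)
Lemma uniform_ergodic phi T : state_preserving_system phi T ->
  (forall y : A, errn phi T y @ \oo --> (0 : R)) ->
  phi_ergodic phi T.
Proof.
move=> [phi_st [Tpos T1] phiT] errn0 f [fcont f_ge0 fZ f1] fT x xpos.
have [phix _] := state_selfadjoint phi x phi_st (positive_dag _ xpos).
set c := complex.Re (phi x) in phix.
have c0 : 0 <= c by have := phi_st.1 _ xpos; rewrite phix -[0]/(0%:C) lecR.
have iter_pos n : positive (iter n T x).
  by elim: n => //= n /Tpos.
have f_iter n : f (iter n T x) = f x.
  by elim: n => //= n <-; rewrite fT.
rewrite phix; congr (_%:C).
have c1pos := positive_scalar (A := A) c c0.
have <- : f (c%:C *: (1 : B)) = c.
  by rewrite fZ ?f1 ?mulr1//; exact: positive1.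
have fc := (subspace_continuousP _ _).1 fcont _ c1pos.
have iter_cvg : (fun n => iter n T x) @ \oo --> (c%:C *: (1 : B) : A).
  apply/cvg_ReP => e e0.
  have near0 : \forall n \near \oo, `|0 - errn phi T x n| < e.
    exact: (cvgrPdist_lt _ _).1 (errn0 x) e e0.
  apply: filterS near0 => n; rewrite sub0r normrN ger0_norm ?nrm_ge0//.
  rewrite /errn phix.
  by rewrite -nrmN opprB.
have : (fun n => f (iter n T x)) @ \oo --> f (c%:C *: (1 : B)).
  (* Continuity of [f] is relative to the cone, so its neighbourhoods constrain positive points
     only; [iter_pos] places the orbit among these. *)
  apply: cvg_comp fc => U U_near.
  have near_U : \forall n \near \oo, positive (iter n T x) -> U (iter n T x).
    exact: iter_cvg U_near.
  by apply: filterS near_U => n; apply.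
have -> : (fun n => f (iter n T x)) = fun=> f x by apply/funext => n.
by move=> /cvg_lim <- //; rewrite lim_cst.
Qed.

(** * The limsup functional and weak convergence of orbits *)

Definition orbit_bound psi T x : set R :=
  [set r | \forall n \near \oo, complex.Re (psi (iter n T x)) <= r].

(* [inf (orbit_bound psi T x)] is the limsup of [psi (T^n x)]. *)
Definition limsup_orbit psi T x : R := inf (orbit_bound psi T x).

Section Limsup.
Context (psi : {scalar A}) (T : {linear A -> A}).
Context (psi_st : is_state psi) (mT : is_markov T).
Local Notation p n x := (complex.Re (psi (iter n T x))).
Local Notation f := (limsup_orbit psi T).

Lemma orbit_positive n x : positive x -> 0 <= p n x.
Proof.
move=> xpos; have [psi_n [psi_pos _] psiE] := state_iter psi T n psi_st mT.
by have := psi_pos _ xpos; rewrite psiE lecE => /andP[].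
Qed.

Lemma orbit_selfadjoint n x : dag x = x -> `|p n x| <= nrm x.
Proof.
move=> xs; have [psi_n psi_n_st psiE] := state_iter psi T n psi_st mT.
by have [_] := state_selfadjoint psi_n x psi_n_st xs; rewrite psiE.
Qed.

Lemma orbit_linear n x y r : p n (x + r%:C *: y) = p n x + r * p n y.
Proof.
rewrite iter_linear.
have -> : psi ((iter n T x : A) + r%:C *: (iter n T y : A)) =
  psi (iter n T x) + r%:C * psi (iter n T y) by rewrite linearD linearZ.
by case: (psi _) => ? ?; case: (psi _) => ? ? /=; rewrite mul0r subr0.
Qed.

Lemma orbit0 n : p n (0 : B) = 0.
Proof. by have := orbit_linear n 0 0 1; rewrite scaler0 addr0; lra. Qed.

Lemma orbitN n x : p n (- x) = - p n x.
Proof.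
have := orbit_linear n 0 x (-1).
by rewrite rmorphN1 scaleN1r add0r orbit0 add0r mulN1r.
Qed.

Lemma orbit1 n : p n (1 : B) = 1.
Proof.
have [psi_n [_ psi1] psiE] := state_iter psi T n psi_st mT.
by rewrite -psiE -[X in psi_n X]/(aone : A) psi1.
Qed.

(** With [orbit_bound_nrm], this makes [inf] a genuine infimum instead of its default value. *)
Lemma orbit_bound_ge0 x : positive x -> lbound (orbit_bound psi T x) 0.
Proof.
move=> xpos r /filter_ex[n]; apply: le_trans; exact: orbit_positive.
Qed.

Lemma limsup_le x r : positive x -> orbit_bound psi T x r -> f x <= r.
Proof. by move=> xpos; apply: ge_inf; exists 0; exact: orbit_bound_ge0. Qed.

Lemma orbit_bound_nrm x : positive x -> orbit_bound psi T x (nrm x).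
Proof.
move=> xpos; apply: nearW => n; apply: le_trans (ler_norm _) _.
exact/orbit_selfadjoint/positive_dag.
Qed.

Lemma limsup_lt x r : positive x -> f x < r -> orbit_bound psi T x r.
Proof.
move=> xpos /inf_lt[|s xs sr]; first by exists (nrm x); exact: orbit_bound_nrm.
by apply: filterS xs => n /le_trans -> //; exact: ltW.
Qed.

Lemma limsup_ge x r : positive x ->
  (forall s, orbit_bound psi T x s -> r <= s) -> r <= f x.
Proof.
move=> xpos h; apply: lb_le_inf => //.
by exists (nrm x); exact: orbit_bound_nrm.
Qed.

(** Each psi o T^n is a state, so it changes by at most |x - y| between [x] and [y], uniformly in
    n. *)
Lemma limsup_lipschitz x y : positive x -> positive y ->
  f y <= f x + nrm (x - y).
Proof.
move=> xpos ypos; rewrite -lerBlDr; apply: limsup_ge => // s xs.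
rewrite lerBlDr; apply: limsup_le => //; apply: filterS xs => n xs.
have : `|p n (x - y)| <= nrm (x - y).
  by apply: orbit_selfadjoint; rewrite dagD dagN !positive_dag.
have := orbit_linear n x y (-1); rewrite rmorphN1 scaleN1r mulN1r => ->.
by rewrite ler_norml => /andP[]; lra.
Qed.

(** Half of homogeneity; applied to [r^-1] and r x it gives the other half in [limsupZ]. *)
Lemma limsupZ_le r x : 0 < r -> positive x -> positive (r%:C *: x) ->
  f (r%:C *: x) <= r * f x.
Proof.
move=> r0 xpos rxpos; rewrite mulrC -ler_pdivrMr//; apply: limsup_ge => // s xs.
rewrite ler_pdivrMr//; apply: limsup_le => //; apply: filterS xs => n xs.
have := orbit_linear n 0 x r; rewrite add0r => ->.
rewrite orbit0.
by rewrite add0r mulrC ler_pM2r.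
Qed.

Lemma positiveZ r x : 0 < r -> positive x -> positive (r%:C *: x).
Proof.
move=> r0 xpos; split.
  by rewrite -[LHS]/(dag (r%:C *: x)) dagZr positive_dag.
move=> l rl.
have r0C : (r%:C : R[i]) != 0 by rewrite (inj_eq (@complexI R)) gt_eqF.
have /(xpos.2) : spectrum x ((r%:C)^-1 * l).
  move=> xl; apply: rl.
  have -> : r%:C *: x - l *: aone = r%:C *: (x - ((r%:C)^-1 * l) *: (1 : B)).
    by rewrite scalerBr scalerA mulrA mulfV// mul1r.
  exact: invertibleZ.
by rewrite pmulr_rge0// invr_gt0 ltcR.
Qed.

Lemma limsupZ r x : 0 <= r -> positive x -> f (r%:C *: x) = r * f x.
Proof.
(* For r = 0 the scaling argument breaks down; the value at 0 is squeezed between 0 and |0|. *)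
move=> r0 xpos; have [->|rN0] := eqVneq r 0.
  have zpos : positive (0 : B).
    by have := positive_scalar (A := A) 0 (lexx 0); rewrite rmorph0 scale0r.
  rewrite rmorph0 scale0r mul0r; apply/eqP; rewrite eq_le.
  have := limsup_le 0 _ zpos (orbit_bound_nrm 0 zpos); rewrite nrm0 => -> /=.
  by apply: limsup_ge => //; exact: orbit_bound_ge0.
have {}r0 : 0 < r by rewrite lt_def rN0.
have rx := positiveZ r x r0 xpos.
apply/eqP; rewrite eq_le limsupZ_le//=.
have ri0 : 0 < r^-1 by rewrite invr_gt0.
have := limsupZ_le r^-1 (r%:C *: x) ri0 rx.
rewrite scalerA -rmorphM mulVf//= scale1r => /(_ xpos).
by rewrite ler_pdivlMl.
Qed.

Lemma limsup_continuous : {within [set x : A | positive x], continuous f}.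
Proof.
apply/subspace_continuousP => x xpos; apply/cvgrPdist_lt => e e0.
have e0C : (0 : R[i]) < e%:C by rewrite ltcR.
have near_x : \forall y \near (x : A), `|(x : A) - y| < e%:C.
  exact: (cvgrPdist_lt _ _).1 (@cvg_id _ (nbhs (x : A))) _ e0C.
rewrite near_withinE; apply: filterS near_x => y xy ypos.
have {}xy : nrm ((x : B) - y) < e by move: xy; rewrite normE ltcR.
have := limsup_lipschitz x y xpos ypos; have := limsup_lipschitz y x ypos xpos.
by rewrite -(nrmN (y - x)) opprB ltr_norml => h1 h2; apply/andP; split; lra.
Qed.

Lemma limsup_S0 : S0 f.
Proof.
split; [exact: limsup_continuous| | exact: limsupZ |].
  by move=> x xpos; apply: limsup_ge => //; exact: orbit_bound_ge0.
have p1 := positive1; apply/eqP; rewrite eq_le; apply/andP; split.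
  by apply: limsup_le => //; apply: nearW => n; rewrite orbit1.
by apply: limsup_ge => // s /filter_ex[n]; rewrite orbit1.
Qed.

(** Applying [T] first shifts the orbit by one index, which leaves the eventual bounds unchanged. *)
Lemma limsup_T x : f (T x) = f x.
Proof.
congr inf; apply/seteqP; split=> r [N _ hN].
  by exists N.+1 => // -[|n]//= Nn; have := hN n Nn; rewrite /= -iterSr.
by exists N => // n /= Nn; rewrite -iterSr; apply: hN; exact: leqW.
Qed.

(** Ergodicity identifies the limsup with phi on the cone, which bounds the orbit eventually from
    above. *)
Lemma ergodic_orbit_lt phi x e : phi_ergodic phi T -> positive x -> 0 < e ->
  \forall n \near \oo, p n x < complex.Re (phi x) + e.
Proof.
move=> erg xpos e0.
rewrite -(erg _ limsup_S0 (fun x _ => limsup_T x) x xpos) /=.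
have /limsup_lt : f x < f x + e / 2 by lra.
by move=> /(_ xpos); apply: filterS => n /le_lt_trans; apply; lra.
Qed.

(** Once |x| cancels, the upper bound for |x| 1 - x becomes the lower bound for [x]. *)
Lemma ergodic_selfadjoint phi x : is_state phi -> phi_ergodic phi T ->
  dag x = x -> (fun n => p n x) @ \oo --> (complex.Re (phi x) : R).
Proof.
move=> phi_st erg xs; apply/cvgrPdist_lt => e e0.
have xNs : dag (- x) = - x by rewrite dagN xs.
have xNle : nrm (- x) <= nrm x by rewrite nrmN.
have phiD y : complex.Re (phi ((nrm x)%:C *: (1 : B) + y)) =
    nrm x + complex.Re (phi y).
  have -> : phi ((nrm x)%:C *: (1 : B) + y) = (nrm x)%:C + phi y.
    by rewrite linearD linearZ /= -[X in phi X]/(aone : A) phi_st.2 mulr1.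
  by rewrite raddfD.
have pD n y : p n ((nrm x)%:C *: (1 : B) + y) = nrm x + p n y.
  by rewrite addrC orbit_linear orbit1 mulr1 addrC.
have h1 := ergodic_orbit_lt phi _ e erg (positive_scalarD x _ xs (lexx _)) e0.
have h2 := ergodic_orbit_lt phi _ e erg (positive_scalarD (- x) _ xNs xNle) e0.
near=> n.
have : p n ((nrm x)%:C *: (1 : B) + x) <
    complex.Re (phi ((nrm x)%:C *: (1 : B) + x)) + e by near: n.
have : p n ((nrm x)%:C *: (1 : B) - x) <
    complex.Re (phi ((nrm x)%:C *: (1 : B) - x)) + e by near: n.
rewrite !pD !phiD orbitN.
have -> : phi (- x) = - phi x by rewrite linearN.
rewrite raddfN /= => le1 le2; rewrite ltr_norml; apply/andP; split; lra.
Unshelve. all: end_near.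
Qed.

Lemma ergodic_cvg phi (x : A) : is_state phi -> phi_ergodic phi T ->
  (fun n => (psi (iter n T x) : R[i]^o)) @ \oo --> (phi x : R[i]^o).
Proof.
move=> phi_st erg.
have selfadjoint y : dag y = y ->
    (fun n => (psi (iter n T y) : R[i]^o)) @ \oo --> (phi y : R[i]^o).
  move=> ys; have [-> _] := state_selfadjoint phi y phi_st ys.
  have -> : (fun n => (psi (iter n T y) : R[i]^o)) =
      fun n => ((p n y)%:C : R[i]^o).
    apply/funext => n.
    have [psi_n psi_n_st psiE] := state_iter psi T n psi_st mT.
    by have [] := state_selfadjoint psi_n y psi_n_st ys; rewrite psiE.
  exact/cvg_realP/ergodic_selfadjoint.
have [a [b [/selfadjoint ca /selfadjoint cb ->]]] := cartesian_decomposition x.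
have -> : phi ((a : B) + 'i *: b) = phi a + 'i * phi b.
  by rewrite linearD linearZ.
have -> : (fun n => (psi (iter n T ((a : B) + 'i *: b)) : R[i]^o)) =
    (fun n => psi (iter n T a) + 'i * psi (iter n T b) : R[i]^o).
  by apply/funext => n; rewrite iter_linear linearD linearZ.
exact: cvg_cartesian.
Qed.

End Limsup.

End Dynamics.

Theorem theorem4p7 (R : realType) (A : cstarAlgType R)
    (phi : {scalar A}) (T : {linear A -> A})
    (sys : state_preserving_system phi T) :
  let cond_i := forall x : A,
    (fun n : nat => (n%:R^-1 * \sum_(0 <= k < n) `|iter k T x - phi x *: aone|
      : R[i]^o)) @ \oo --> (0 : R[i]^o) in
  let cond_ii := forall x : A,
    (fun n : nat => (`|iter n T x - phi x *: aone| : R[i]^o)) @ \oo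
      --> (0 : R[i]^o) in
  let cond_iii := phi_ergodic phi T in
  let cond_iv := forall psi : {scalar A}, is_state psi -> forall x : A,
    (fun n : nat => (psi (iter n T x) : R[i]^o)) @ \oo
      --> (phi x : R[i]^o) in
  [/\ cond_i <-> cond_ii, cond_ii -> cond_iii & cond_iii -> cond_iv].
Proof.
move=> cond_i cond_ii cond_iii cond_iv; have [phi_st mT _] := sys; split.
- split=> [h x|h x].
    apply/cvg_errnE/cvg0_errn => // {}x xs; apply: mean_cvg0.
    + by move=> n; exact: nrm_ge0.
    + exact: errn_nonincreasing.
    + exact/cvg_mean_errnE/h.
  exact/cvg_mean_errnE/cvg0_mean/cvg_errnE/h.
- by move=> h; apply: uniform_ergodic => // x; exact/cvg_errnE/h.
- by move=> erg psi psi_st x; exact: ergodic_cvg.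
Qed.
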